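(* Let $(R,\mathfrak m,k)$ be a Burch local ring of depth zero that is not a field. Let $M$ be a finitely generated $R$-module, and let $(F,\partial)$ be a minimal free resolution of $M$. The following are equivalent: (1) The ideal $I(M)$ of $R$ generated by all entries of the matrices $\partial_i$, $i>0$, is equal to $\mathfrak m$. (2) The $R$-module $k$ is a direct summand of $\Omega^r_R M$ for some $r\ge 2$.
   Context: All rings are commutative and noetherian. An ideal $I$ of a local ring $(S,\mathfrak n)$ is a Burch ideal if $\mathfrak n I\neq\mathfrak n(I:_S\mathfrak n)$. A local ring $(R,\mathfrak m)$ of depth $t$ with completion $\widehat R$ is a Burch ring if there exist a maximal $\widehat R$-regular sequence $\boldsymbol{x}=x_1,\dots,x_t$ in $\widehat R$, a regular local ring $S$ and a Burch ideal $I$ of $S$ with $\widehat R/(\boldsymbol{x})\cong S/I$. $\Omega^i_R M$ denotes the $i$-th syzygy of $M$ in its minimal free resolution. *)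

(* Defs.v *)
From HB Require Import structures.
From mathcomp Require Import all_boot all_order all_algebra.
From mathcomp Require Import boolp classical_sets functions.
From mathcomp Require Import ring.

Set Implicit Arguments.
Unset Strict Implicit.
Unset Printing Implicit Defensive.

Import GRing.Theory.
Local Open Scope classical_set_scope.
Local Open Scope quotient_scope.
Local Open Scope ring_scope.

(* Ideals, possibly improper, are classical sets.  MathComp's [idealr A] is the
   type of proper ideals, the ones whose quotient is a [comNzRingType]. *)

Section Ideals.
Variable A : comNzRingType.

Definition is_ideal (I : set A) : Prop :=
  [/\ I 0, (forall x y, I x -> I y -> I (x + y)) & (forall a x, I x -> I (a * x))].

Definition ideal_gen (X : set A) : set A := smallest is_ideal X.

Definition ideal_mul (I J : set A) : set A :=
  ideal_gen [set z | exists x y, [/\ I x, J y & z = x * y]].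

Definition ideal_exp (I : set A) (n : nat) : set A :=
  iter n (ideal_mul I) [set: A].

Definition colon (I J : set A) : set A :=
  [set x | forall y, J y -> I (x * y)].

Definition noetherian_ring : Prop :=
  forall I : set A, is_ideal I -> exists xs : seq A, I = ideal_gen [set` xs].

Definition maximal_ideal (I : set A) : Prop :=
  [/\ is_ideal I, I != [set: A] &
      forall J, is_ideal J -> I `<=` J -> J = I \/ J = [set: A]].

Definition is_field : Prop := forall x : A, x != 0 -> exists y, x * y = 1.

(* Properness of the generated ideal makes the terms lie in the maximal ideal
   when A is local. *)
Definition regular_sequence (xs : seq A) : Prop :=
  (forall i, (i < size xs)%N -> forall a : A,
     ideal_gen [set` take i xs] (nth 0 xs i * a) ->
     ideal_gen [set` take i xs] a) /\
  ideal_gen [set` xs] != [set: A].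

Definition maximal_regular_sequence (xs : seq A) : Prop :=
  regular_sequence xs /\ forall y, ~ regular_sequence (rcons xs y).

Definition has_depth (t : nat) : Prop :=
  (exists xs, regular_sequence xs /\ size xs = t) /\
  (forall xs, regular_sequence xs -> (size xs <= t)%N).

Definition prime_chain (d : nat) : Prop :=
  exists P : 'I_d.+1 -> prime_idealr A,
    forall i j : 'I_d.+1, (i < j)%N -> [set` P i] `<` [set` P j].

Definition has_krull_dim (d : nat) : Prop :=
  prime_chain d /\ forall e, prime_chain e -> (e <= d)%N.

Definition min_number_of_generators (I : set A) (d : nat) : Prop :=
  (exists xs : seq A, I = ideal_gen [set` xs] /\ size xs = d) /\
  (forall xs : seq A, I = ideal_gen [set` xs] -> (d <= size xs)%N).

Lemma ideal_gen_ideal (X : set A) : is_ideal (ideal_gen X).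
Proof.
split=> [I [[]]//|x y Ix Iy I HI|a x Ix I HI].
- by case: (HI) => -[_ addI _] _; apply: addI; [exact: Ix|exact: Iy].
- by case: (HI) => -[_ _ mulI] _; apply: mulI; exact: Ix.
Qed.

Lemma ideal_expP (I : set A) n : is_ideal (ideal_exp I n).
Proof. by case: n => [|n]; [split|exact: ideal_gen_ideal]. Qed.

Lemma ideal_exp0 (I : set A) n : ideal_exp I n 0.
Proof. by have [] := ideal_expP I n. Qed.

Lemma ideal_expD (I : set A) n x y :
  ideal_exp I n x -> ideal_exp I n y -> ideal_exp I n (x + y).
Proof. by have [_ + _] := ideal_expP I n; exact. Qed.

Lemma ideal_expM (I : set A) n a x : ideal_exp I n x -> ideal_exp I n (a * x).
Proof. by have [_ _ +] := ideal_expP I n; exact. Qed.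

Lemma ideal_expN (I : set A) n x : ideal_exp I n x -> ideal_exp I n (- x).
Proof. by move=> ?; rewrite -mulN1r; exact: ideal_expM. Qed.

End Ideals.

Definition noetherian_local_ring (A : comNzRingType) (m : idealr A) : Prop :=
  [/\ noetherian_ring A, maximal_ideal [set` m] &
      forall I : set A, maximal_ideal I -> I = [set` m]].

Definition regular_local_ring (A : comNzRingType) (m : idealr A) : Prop :=
  noetherian_local_ring m /\
  exists d, has_krull_dim A d /\ min_number_of_generators [set` m] d.

Definition burch_ideal (A : comNzRingType) (m I : idealr A) : Prop :=
  ideal_mul [set` m] [set` I] <> ideal_mul [set` m] (colon [set` I] [set` m]).

(* The m-adic completion: Cauchy sequences modulo null sequences. *)
Section Completion.
Variables (A : comNzRingType) (m : idealr A).

Definition adic_cauchy : pred (nat -> A) := fun x =>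
  `[< forall n, exists N, forall i j, (N <= i)%N -> (N <= j)%N ->
        ideal_exp [set` m] n (x i - x j) >].

Lemma adic_cauchy_subring : subring_closed adic_cauchy.
Proof.
split.
- by apply/asboolP => n; exists 0%N => i j _ _; rewrite subrr; exact: ideal_exp0.
- move=> x y /asboolP xC /asboolP yC; apply/asboolP => n.
  have [N xN] := xC n; have [M yM] := yC n; exists (maxn N M) => i j.
  rewrite !geq_max => /andP[iN iM] /andP[jN jM].
  have -> : (x - y) i - (x - y) j = (x i - x j) + - (y i - y j).
    by rewrite !fctE; ring.
  by apply: ideal_expD; [exact: xN|apply: ideal_expN; exact: yM].
- move=> x y /asboolP xC /asboolP yC; apply/asboolP => n.
  have [N xN] := xC n; have [M yM] := yC n; exists (maxn N M) => i j.
  rewrite !geq_max => /andP[iN iM] /andP[jN jM].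
  have -> : (x * y) i - (x * y) j = x i * (y i - y j) + y j * (x i - x j).
    by rewrite !fctE; ring.
  by apply: ideal_expD; apply: ideal_expM; [exact: yM|exact: xN].
Qed.

HB.instance Definition _ :=
  GRing.isSubringClosed.Build (nat -> A) adic_cauchy adic_cauchy_subring.

Definition cauchy_seq : Type := {x : nat -> A | adic_cauchy x}.

HB.instance Definition _ := SubChoice.on cauchy_seq.
HB.instance Definition _ :=
  [SubChoice_isSubComNzRing of cauchy_seq by <:].

Definition adic_null : pred cauchy_seq := fun x =>
  `[< forall n, exists N, forall i, (N <= i)%N ->
        ideal_exp [set` m] n (val x i) >].

Lemma adic_null_ideal : idealr_closed adic_null.
Proof.
split.
- by apply/asboolP => n; exists 0%N => i _; rewrite raddf0; exact: ideal_exp0.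
- apply/negP => /asboolP/(_ 1%N)[N /(_ N (leqnn N))]; rewrite rmorph1.
  move=> /(_ [set` m]) H; have : [set` m] (1 : A).
    apply: H; split; first split => /=.
    + exact: rpred0.
    + by move=> x y; exact: rpredD.
    + by move=> a x; exact: idealMr.
    + by move=> z [x [y [xm _ ->]]] /=; rewrite mulrC idealMr.
  by rewrite /= idealr1.
- move=> a x y /asboolP x0 /asboolP y0; apply/asboolP => n.
  have [N xN] := x0 n; have [M yM] := y0 n; exists (maxn N M) => i.
  rewrite geq_max => /andP[iN iM]; rewrite rmorphD rmorphM.
  by apply: ideal_expD; [apply: ideal_expM; exact: xN|exact: yM].
Qed.

HB.instance Definition _ :=
  isIdealr.Build cauchy_seq adic_null adic_null_ideal.

Definition completion : comNzRingType :=
  {ideal_quot (adic_null : idealr cauchy_seq)}.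

End Completion.

Definition burch_ring (A : comNzRingType) (m : idealr A) : Prop :=
  exists t (xs : seq (completion m)) (X : idealr (completion m)),
    [/\ has_depth A t, maximal_regular_sequence xs /\ size xs = t,
        [set` X] = ideal_gen [set` xs] &
        exists (S : comNzRingType) (n I : idealr S),
          [/\ regular_local_ring n, burch_ideal n I &
              exists f : {rmorphism {ideal_quot X} -> {ideal_quot I}},
                bijective f]].

(* The quotient A/I as an A-module. *)
Section QuotientModule.
Variables (A : comNzRingType) (I : idealr A).

Definition quot_module : Type := {ideal_quot I}.

HB.instance Definition _ := GRing.ComNzRing.on quot_module.

Definition quot_scale (a : A) (x : quot_module) : quot_module :=
  (\pi_{ideal_quot I} a : quot_module) * x.

Lemma quot_scaleA a b x : quot_scale a (quot_scale b x) = quot_scale (a * b) x.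
Proof. by rewrite /quot_scale rmorphM mulrA. Qed.
Lemma quot_scale1 : left_id 1 quot_scale.
Proof. by move=> x; rewrite /quot_scale rmorph1 mul1r. Qed.
Lemma quot_scaleDr : right_distributive quot_scale +%R.
Proof. by move=> a x y; exact: mulrDr. Qed.
Lemma quot_scaleDl x : {morph quot_scale^~ x : a b / a + b}.
Proof. by move=> a b; rewrite /quot_scale rmorphD mulrDl. Qed.

HB.instance Definition _ := GRing.Zmodule_isLmodule.Build A quot_module
  quot_scaleA quot_scale1 quot_scaleDr quot_scaleDl.

End QuotientModule.

(* The submodule of A^n spanned by the rows of D, that is, the image of the
   linear map A^k -> A^n of matrix D acting on row vectors. *)
Section ImageModule.
Variables (A : comNzRingType) (k n : nat) (D : 'M[A]_(k, n)).

Definition in_image : pred 'rV[A]_n := fun v => `[< exists u, v = u *m D >].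

Lemma in_image_submod : submod_closed in_image.
Proof.
split; first by apply/asboolP; exists 0; rewrite mul0mx.
move=> a v w /asboolP[x ->] /asboolP[y ->]; apply/asboolP.
by exists (a *: x + y); rewrite mulmxDl scalemxAl.
Qed.

HB.instance Definition _ :=
  GRing.isSubmodClosed.Build A 'rV[A]_n in_image in_image_submod.

Definition image_module : Type := {v : 'rV[A]_n | in_image v}.

HB.instance Definition _ := SubChoice.on image_module.
HB.instance Definition _ := [SubChoice_isSubLmodule of image_module by <:].

End ImageModule.

Section Resolutions.
Variables (A : comNzRingType) (m : idealr A).

Definition finitely_generated (M : lmodType A) : Prop :=
  exists n (v : 'I_n -> M), forall x, exists c : 'I_n -> A,
    x = \sum_(i < n) c i *: v i.

(* F_i is A^(rk i), of row vectors, and [diff i] is the matrix of the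
   differential F_(i+1) -> F_i: the indices of the differentials are shifted
   by one. *)
Record minimal_free_resolution (M : lmodType A) := MinimalFreeResolution {
  rk : nat -> nat;
  diff : forall i, 'M[A]_(rk i.+1, rk i);
  augmentation : {linear 'rV[A]_(rk 0%N) -> M};
  augmentation_surj : forall x, exists v, augmentation v = x;
  exact_augmentation : forall v,
    augmentation v = 0 <-> exists u, v = u *m diff 0%N;
  exact_diff : forall i (v : 'rV[A]_(rk i.+1)),
    v *m diff i = 0 <-> exists u, v = u *m diff i.+1;
  minimal_diff : forall i a b, diff i a b \in (m : pred A)
}.

Variables (M : lmodType A) (F : minimal_free_resolution M).

Definition entries_ideal : set A :=
  ideal_gen [set x | exists i a b, x = diff F i a b].

Definition syzygy (r : nat) : lmodType A :=
  if r is i.+1 then image_module (diff F i) else M.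

End Resolutions.

Definition direct_summand (A : comNzRingType) (K N : lmodType A) : Prop :=
  exists (L : lmodType A) (f : {linear N -> (K * L)%type}), bijective f.

(* Main.v *)
From HB Require Import structures.
Require Import Defs.
From mathcomp Require Import all_boot all_order all_algebra.
From mathcomp Require Import boolp classical_sets functions.
From mathcomp Require Import ring.
Set Implicit Arguments.
Unset Strict Implicit.
Unset Printing Implicit Defensive.
Import GRing.Theory.
Local Open Scope classical_set_scope.
Local Open Scope quotient_scope.
Local Open Scope ring_scope.

(* If [k] is a summand of a syzygy, the next differential contains a
   presentation of [k], whose entries generate [m].

   Conversely, write the completion of [R] as [S/I] with [n I <> n (I : n)]. A
   syzygy [Z = ker (F_i -> F_(i-1))], [i >= 1], contains [soc F_i], and [k] is
   a summand of [Z] as soon as some socle element lies outside [m Z]. So if no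
   such [Z] has [k] as a summand, then every [c] in [soc R] satisfies
   [c e = sum x_j z_j] with [x_j] in [m] and [z_j] in [Z], for each basis
   vector [e] of [F_i]. Lifting to [S], where [c] becomes an element [b] of
   [(I : n)], and applying a lift of the differential gives [b d] in [n I] for
   every entry [d]. As these entries generate [m], [b n] is contained in
   [n I] for all [b] in [(I : n)], contradicting the Burch property.

   The descent from the completion to [R] needs only that the socle of the
   completion comes from [soc R], by Artin-Rees, and that the completion is
   [R] plus the extension of [m]. *)

(** * Ideals and the Artin-Rees lemma *)

Section IdealFacts.
Variable A : comNzRingType.
Implicit Types (I J K Q m : set A) (x y z a b : A).

Lemma is_ideal0 I : is_ideal I -> I 0. Proof. by case. Qed.

Lemma is_idealD I x y : is_ideal I -> I x -> I y -> I (x + y).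
Proof. by case=> _ + _; exact. Qed.

Lemma is_idealMl I a x : is_ideal I -> I x -> I (a * x).
Proof. by case=> _ _; exact. Qed.

Lemma is_idealMr I a x : is_ideal I -> I x -> I (x * a).
Proof. by rewrite mulrC; exact: is_idealMl. Qed.

Lemma is_idealN I x : is_ideal I -> I x -> I (- x).
Proof. by rewrite -mulN1r; exact: is_idealMl. Qed.

Lemma is_idealB I x y : is_ideal I -> I x -> I y -> I (x - y).
Proof. by move=> II Ix Iy; apply: is_idealD => //; exact: is_idealN. Qed.

Lemma is_ideal_sum I (T : Type) (r : seq T) (P : pred T) (f : T -> A) :
  is_ideal I -> (forall i, P i -> I (f i)) -> I (\sum_(i <- r | P i) f i).
Proof.
move=> II If; apply: (big_ind (fun x => I x)) => //; first exact: is_ideal0.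
by move=> x y; exact: is_idealD.
Qed.

Lemma idealr_is_ideal (I : idealr A) : is_ideal [set` I].
Proof.
split=> /= [|x y|a x]; [exact: rpred0|exact: rpredD|exact: idealMr].
Qed.

Lemma ideal_gen_sub (X : set A) : X `<=` ideal_gen X.
Proof. exact: sub_gen_smallest. Qed.

Lemma ideal_gen_min (X : set A) I :
  is_ideal I -> X `<=` I -> ideal_gen X `<=` I.
Proof. exact: smallest_sub. Qed.

Lemma ideal_mul_prod I J x y : I x -> J y -> ideal_mul I J (x * y).
Proof. by move=> Ix Jy; apply: ideal_gen_sub; exists x, y. Qed.

Lemma ideal_mul_min I J Q : is_ideal Q ->
  (forall x y, I x -> J y -> Q (x * y)) -> ideal_mul I J `<=` Q.
Proof.
by move=> QI IJQ; apply: ideal_gen_min => // _ [x [y [Ix Jy ->]]]; exact: IJQ.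
Qed.

Definition ideal_add I J : set A := [set z | exists x y, [/\ I x, J y & z = x + y]].

Lemma ideal_add_ideal I J : is_ideal I -> is_ideal J -> is_ideal (ideal_add I J).
Proof.
move=> II JI; split.
- by exists 0, 0; rewrite addr0; split => //; exact: is_ideal0.
- move=> _ _ [x [y [Ix Jy ->]]] [z [t [Iz Jt ->]]].
  by exists (x + z), (y + t); split; [exact: is_idealD|exact: is_idealD|ring].
- move=> a _ [x [y [Ix Jy ->]]].
  by exists (a * x), (a * y); split; [exact: is_idealMl|exact: is_idealMl|ring].
Qed.

Lemma ideal_addl I J : is_ideal J -> I `<=` ideal_add I J.
Proof.
by move=> JI x Ix; exists x, 0; rewrite addr0; split => //; exact: is_ideal0.
Qed.

Lemma ideal_addr I J : is_ideal I -> J `<=` ideal_add I J.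
Proof.
by move=> II x Jx; exists 0, x; rewrite add0r; split => //; exact: is_ideal0.
Qed.

Lemma colon_ideal I J : is_ideal I -> is_ideal (colon I J).
Proof.
move=> II; split.
- by move=> y _; rewrite mul0r; exact: is_ideal0.
- by move=> x y Ix Iy z Jz; rewrite mulrDl; apply: is_idealD => //; [exact: Ix|exact: Iy].
- by move=> a x Ix z Jz; rewrite -mulrA; apply: is_idealMl => //; exact: Ix.
Qed.

Lemma image_mull_ideal y I : is_ideal I -> is_ideal [set y * x | x in I].
Proof.
move=> II; split.
- by exists 0; rewrite ?mulr0 //; exact: is_ideal0.
- by move=> _ _ [u Iu <-] [v Iv <-]; exists (u + v); rewrite ?mulrDr //; exact: is_idealD.
- by move=> a _ [u Iu <-]; exists (a * u); [exact: is_idealMl|rewrite mulrCA].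
Qed.

Lemma setI_ideal I J : is_ideal I -> is_ideal J -> is_ideal (I `&` J).
Proof.
move=> II JI; split; first by split; exact: is_ideal0.
- by move=> x y [Ix Jx] [Iy Jy]; split; exact: is_idealD.
- by move=> a x [Ix Jx]; split; exact: is_idealMl.
Qed.

Lemma set1_0_ideal : is_ideal [set 0 : A].
Proof.
by split=> //= [x y -> ->|a x ->]; rewrite ?addr0 ?mulr0.
Qed.

Lemma setT_ideal : is_ideal [set: A]. Proof. by split. Qed.

Lemma ideal_gen_seqP (xs : seq A) x : ideal_gen [set` xs] x ->
  exists c : 'I_(size xs) -> A, x = \sum_(j < size xs) xs`_j * c j.
Proof.
set Q := [set z | exists c : 'I_(size xs) -> A, z = \sum_(j < size xs) xs`_j * c j].
suff : ideal_gen [set` xs] `<=` Q by exact.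
apply: ideal_gen_min; first split.
- by exists (fun=> 0); rewrite big1 // => i _; rewrite mulr0.
- move=> _ _ [c ->] [d ->]; exists (fun j => c j + d j).
  by rewrite -big_split /=; apply: eq_bigr => i _; rewrite mulrDr.
- move=> a _ [c ->]; exists (fun j => a * c j).
  by rewrite big_distrr /=; apply: eq_bigr => i _; rewrite mulrCA.
- move=> y /= yxs; have ylt : (index y xs < size xs)%N by rewrite index_mem.
  exists (fun j => (j == Ordinal ylt)%:R).
  rewrite (bigD1 (Ordinal ylt)) //= eqxx mulr1 nth_index // big1 ?addr0 // => i.
  by move=> /negPf ->; rewrite mulr0.
Qed.

Lemma ideal_mul_genP (xs : seq A) J x : is_ideal J ->
  ideal_mul (ideal_gen [set` xs]) J x ->
  exists c : 'I_(size xs) -> A,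
    (forall j, J (c j)) /\ x = \sum_(j < size xs) xs`_j * c j.
Proof.
move=> JI.
set Q := [set z | exists c : 'I_(size xs) -> A,
    (forall j, J (c j)) /\ z = \sum_(j < size xs) xs`_j * c j].
suff : ideal_mul (ideal_gen [set` xs]) J `<=` Q by exact.
apply: ideal_mul_min; first split.
- exists (fun=> 0); split; first by move=> _; exact: is_ideal0.
  by rewrite big1 // => i _; rewrite mulr0.
- move=> _ _ [c [Jc ->]] [d [Jd ->]]; exists (fun j => c j + d j).
  split; first by move=> j; exact: is_idealD.
  by rewrite -big_split /=; apply: eq_bigr => i _; rewrite mulrDr.
- move=> a _ [c [Jc ->]]; exists (fun j => a * c j).
  split; first by move=> j; exact: is_idealMl.
  by rewrite big_distrr /=; apply: eq_bigr => i _; rewrite mulrCA.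
- move=> y z /ideal_gen_seqP[c ->] Jz; exists (fun j => c j * z).
  split; first by move=> j; exact: is_idealMl.
  by rewrite big_distrl /=; apply: eq_bigr => i _; rewrite mulrA.
Qed.

(** Induction on [k] for all [Q] at once: the outermost factor [x] in [m] is absorbed by passing to
    [(Q : x)]. It replaces the law [m^(j+k) = m^j m^k]. *)
Lemma ideal_exp_mul_min m J Q k : is_ideal Q ->
  (forall u v, ideal_exp m k u -> J v -> Q (u * v)) -> iter k (ideal_mul m) J `<=` Q.
Proof.
elim: k Q => [|k IH] Q QI H /=.
  by move=> x Jx; rewrite -[x]mul1r; exact: H.
apply: ideal_mul_min => // x y mx /(IH (colon Q [set x])).
rewrite mulrC; apply => //; first exact: colon_ideal.
move=> u v mu Jv _ ->; rewrite -mulrA [v * x]mulrC mulrA [u * x]mulrC.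
by apply: H => //; exact: ideal_mul_prod.
Qed.

Lemma ideal_exp_le m j k : (j <= k)%N -> ideal_exp m k `<=` ideal_exp m j.
Proof.
move=> /subnK <-; rewrite /ideal_exp iterD.
apply: ideal_exp_mul_min; first exact: ideal_expP.
by move=> u v _; exact: ideal_expM.
Qed.

Lemma ideal_exp1 m : is_ideal m -> ideal_exp m 1 = m.
Proof.
move=> mI; apply/seteqP; split.
  by apply: ideal_mul_min => // x y mx _; exact: is_idealMr.
by move=> x mx; rewrite -[x]mulr1; exact: ideal_mul_prod.
Qed.

Lemma ideal_expX m k x : m x -> ideal_exp m k (x ^+ k).
Proof. by move=> mx; elim: k => // k IH; rewrite exprS; exact: ideal_mul_prod. Qed.

End IdealFacts.

(** * Noetherian induction, units of local rings, consequences of Artin-Rees *)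

Section Noetherian.
Variable A : comNzRingType.
Hypothesis A_noeth : noetherian_ring A.
Implicit Types (I J K Q m : set A) (x y z a b : A).

(** Zorn's lemma applies because the union of a chain is a finitely generated ideal, and one member
    of the chain already contains all the generators. *)
Lemma noetherian_max_ideal (P : set A -> Prop) I : is_ideal I -> P I ->
  exists K, [/\ is_ideal K, P K & forall J, is_ideal J -> P J -> K `<=` J -> J `<=` K].
Proof.
move=> II PI.
pose P' := [set X : set A | X = set0 \/ is_ideal X /\ P X].
have [F FP Ftot|K [KP Kmax]] := @Zorn_bigcup A P'; last first.
  have {KP} [K0|[KI PK]] := KP.
    exfalso; apply: (Kmax I); last by right.
    by rewrite K0; split=> [x //|] /(_ 0); apply; exact: is_ideal0.
  exists K; split=> // J JI PJ KJ; apply: contrapT => JK.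
  by apply: (Kmax J); [split|right].
have [F0|] := pselect (forall X, F X -> X = set0).
  by left; apply/seteqP; split=> // x [X /F0 ->].
move=> /existsNP[X0 /not_implyP[FX0 X00]].
have FI X x : F X -> X x -> is_ideal X /\ P X by move=> /FP[->|].
have [X0I _] : is_ideal X0 /\ P X0 by have [|//] := FP _ FX0.
have UI : is_ideal (\bigcup_(X in F) X).
  split; first by exists X0 => //; exact: is_ideal0.
  - move=> x y [X FX Xx] [Y FY Yy].
    have [XI _] := FI _ _ FX Xx; have [YI _] := FI _ _ FY Yy.
    have [XY|YX] := Ftot _ _ FX FY.
      by exists Y => //; apply: is_idealD => //; exact: XY.
    by exists X => //; apply: is_idealD => //; exact: YX.
  - move=> a x [X FX Xx]; exists X => //; apply: is_idealMl => //.
    by have [] := FI _ _ FX Xx.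
have [xs Uxs] := A_noeth UI.
have : exists X, [/\ F X, is_ideal X & [set` xs] `<=` X].
  have : [set` xs] `<=` \bigcup_(X in F) X by rewrite Uxs; exact: ideal_gen_sub.
  elim: (xs) => [|x s IH] sU; first by exists X0.
  have [|X [FX XI sX]] := IH.
    by move=> y ys; apply: sU; rewrite /= in_cons ys orbT.
  have [Y FY Yx] : (\bigcup_(X in F) X) x by apply: sU; rewrite /= mem_head.
  have [YI _] := FI _ _ FY Yx.
  have [XY|YX] := Ftot _ _ FX FY; [exists Y|exists X]; split => // y;
    rewrite /= in_cons => /predU1P[->//|ys]; [|exact: YX|exact: sX].
  by apply: XY; exact: sX.
move=> [X [FX XI xsX]]; right; split=> //.
suff -> : \bigcup_(X in F) X = X by have [] := FI _ _ FX (is_ideal0 XI).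
by apply/seteqP; split; [rewrite Uxs; exact: ideal_gen_min|move=> x; exists X].
Qed.

(** Otherwise [xA] is proper, and an ideal maximal among those containing it but not [1] is a
    maximal ideal, hence [m]. *)
Lemma local_unit (m : idealr A) x : noetherian_local_ring m ->
  x \notin (m : pred A) -> exists y, x * y = 1.
Proof.
move=> [_ _ muniq] xm; apply: contrapT => xunit.
have xI : is_ideal [set x * y | y in [set: A]].
  exact: image_mull_ideal (@setT_ideal A).
have [|K [KI [xK K1] Kmax]] := @noetherian_max_ideal
  (fun K => [set x * y | y in [set: A]] `<=` K /\ ~ K 1) _ xI.
  by split=> // -[y _ xy]; apply: xunit; exists y.
have Km : K = [set` m].
  apply: muniq; split=> // [|J JI KJ].
    by apply/eqP => KT; apply: K1; rewrite KT.
  have [J1|J1] := pselect (J 1).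
    by right; apply/seteqP; split=> // y _; rewrite -[y]mulr1; exact: is_idealMl.
  by left; apply/seteqP; split=> //; apply: Kmax => //; split=> // y /xK /KJ.
have : K x by apply: xK; exists 1; rewrite ?mulr1.
by rewrite Km /= (negPf xm).
Qed.

Section PowersInIdeal.
Variables (m : set A) (m_ideal : is_ideal m).

(** Take a maximal counterexample [W] and [y] in [m] outside [W], with [y^(r+1)] but not [y^r] in
    [W]. Both [W + (y)] and [(W : y)] are strictly larger, so they contain powers of [m], and their
    product lies in [W]. *)
Lemma exp_sub_of_nilpotent K : is_ideal K ->
  (forall y, m y -> exists s, K (y ^+ s)) -> exists N, ideal_exp m N `<=` K.
Proof.
move=> KI mK; apply: contrapT => noN.
have [|W [WI [KW noNW] Wmax]] := @noetherian_max_ideal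
  (fun Q => K `<=` Q /\ ~ exists N, ideal_exp m N `<=` Q) K KI.
  by split.
have big Q : is_ideal Q -> W `<=` Q -> ~ (Q `<=` W) -> exists N, ideal_exp m N `<=` Q.
  move=> QI WQ QW; apply: contrapT => noNQ; apply: QW; apply: Wmax => //.
  by split=> // x /KW /WQ.
apply: (noNW); exists 1%N; rewrite ideal_exp1 // => y my.
apply: contrapT => yW; apply: noNW.
have [s Ws] : exists s, W (y ^+ s) by have [s /KW] := mK y my; exists s.
have [r [Wr nWr]] : exists r, W (y ^+ r.+1) /\ ~ W (y ^+ r).
  elim: s Ws => [|s IH] Ws.
    by exfalso; apply: yW; rewrite -[y]mulr1; exact: is_idealMl.
  by have [/IH|] := pselect (W (y ^+ s)) => //; exists s.
pose Q1 := ideal_add W [set y * a | a in [set: A]].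
pose Q2 := colon W [set y].
have TI := @setT_ideal A.
have yI := image_mull_ideal y TI.
have Q1I : is_ideal Q1 by exact: ideal_add_ideal.
have Q2I : is_ideal Q2 by exact: colon_ideal.
have [|H|N1 N1P] := big Q1 Q1I; first exact: ideal_addl.
  by apply: yW; apply: H; apply: ideal_addr => //; exists 1; rewrite ?mulr1.
have [|H|N2 N2P] := big Q2 Q2I; first by move=> x Wx z _; exact: is_idealMr.
  by apply: nWr; apply: H => _ ->; rewrite -exprSr.
exists (N1 + N2)%N; rewrite /ideal_exp iterD; apply: ideal_exp_mul_min => //.
move=> u v /N1P[w [t [Ww [a _ <-{t}] ->]]] /N2P/(_ y erefl) Wvy.
rewrite mulrDl; apply: is_idealD => //; first exact: is_idealMr.
have -> : y * a * v = a * (v * y) by ring.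
exact: is_idealMl.
Qed.

(* A form of the Artin-Rees lemma. Among the ideals containing [Q] and meeting
   [J] inside [Q], a maximal [K] contains a power of every [y] in [m]: if
   [(K : y^s)] is stationary from [s] on, then [K + (y^s)] still meets [J]
   inside [Q]. *)
Lemma artin_rees J Q n : is_ideal J -> is_ideal Q ->
  (forall y u, m y -> J u -> Q (y ^+ n * u)) ->
  exists N, ideal_exp m N `&` J `<=` Q.
Proof.
move=> JI QI mJQ.
have [|K [KI [QK KJ] Kmax]] := @noetherian_max_ideal
  (fun K => Q `<=` K /\ K `&` J `<=` Q) Q QI.
  by split=> // x [].
have [||N NK] := @exp_sub_of_nilpotent K => //; last first.
  by exists N => x [/NK Kx Jx]; apply: KJ.
move=> y my; pose C s := colon K [set y ^+ s].
have CI s : is_ideal (C s) by exact: colon_ideal.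
have [|_ [_ [s ->] Cmax]] := @noetherian_max_ideal
  (fun X => exists s, X = C s) (C 0%N) (CI 0%N); first by exists 0%N.
have Cs a : K (a * y ^+ (n + s)) -> K (a * y ^+ s).
  move=> Ka; suff : C s a by exact.
  apply: (Cmax (C (n + s)%N)) => //.
  - by exists (n + s)%N.
  - move=> b Cb _ ->; rewrite exprD mulrCA.
    by apply: is_idealMl => //; exact: Cb.
  - by move=> _ ->.
exists s.
pose K' := ideal_add K [set y ^+ s * a | a in [set: A]].
have yI := image_mull_ideal (y ^+ s) (@setT_ideal A).
suff : K' `<=` K by apply; apply: ideal_addr => //; exists 1; rewrite ?mulr1.
apply: Kmax; [exact: ideal_add_ideal| |exact: ideal_addl].
split; first by move=> x /QK; exact: ideal_addl.
move=> _ [[k [t [Kk [a _ <-{t}] ->]]] Ju]; apply: KJ; split=> //.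
apply: is_idealD => //; rewrite mulrC; apply: Cs.
(* Multiplying the element [k + y^s a] of [J] by [y^n] lands in [Q], so [y^(n+s) a] is in [K];
   stationarity then removes [y^n]. *)
have /QK := mJQ y _ my Ju; rewrite mulrDr => H.
have -> : a * y ^+ (n + s) = (y ^+ n * k + y ^+ n * (y ^+ s * a)) - y ^+ n * k.
  by rewrite exprD; ring.
by apply: is_idealB => //; exact: is_idealMl.
Qed.

(** This is [artin_rees] for [J = yA] and [Q = y m^n]. *)
Lemma artin_rees_mull y n : exists N, forall x,
  ideal_exp m N (y * x) -> exists2 z, ideal_exp m n z & y * x = y * z.
Proof.
have [||z t mz [x _ <-{t}]|N NP] := @artin_rees [set y * a | a in [set: A]]
  [set y * a | a in ideal_exp m n] n.
- exact: image_mull_ideal (@setT_ideal A).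
- exact: image_mull_ideal (ideal_expP _ _).
- exists (z ^+ n * x) => /=; last by rewrite mulrCA.
  by rewrite mulrC; apply: ideal_expM; exact: ideal_expX.
- exists N => x mx; have [|z mz <-] := NP (y * x); last by exists z.
  by split=> //; exists x.
Qed.

(** This is [artin_rees] for the ideal [I + J] and [Q = (I & m^n) + (J & m^n)], where [&] is
    intersection: a small sum is a sum of small terms. *)
Lemma artin_rees_add I J n : is_ideal I -> is_ideal J -> exists N, forall x y,
  I x -> J y -> ideal_exp m N (x + y) ->
  exists x' y', [/\ I x', J y', ideal_exp m n x', ideal_exp m n y' & x + y = x' + y'].
Proof.
move=> II JI.
have expI k := ideal_expP m k.
have [||z t mz [x [y [Ix Jy ->]]]|N NP] := @artin_rees (ideal_add I J)
  (ideal_add (I `&` ideal_exp m n) (J `&` ideal_exp m n)) n.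
- exact: ideal_add_ideal.
- by apply: ideal_add_ideal; exact: setI_ideal.
- exists (z ^+ n * x), (z ^+ n * y); split; last by rewrite mulrDr.
    by split; [exact: is_idealMl|apply: is_idealMr => //; exact: ideal_expX].
  by split; [exact: is_idealMl|apply: is_idealMr => //; exact: ideal_expX].
- exists N => x y Ix Jy mxy; have [|x' [y' [[Ix' mx'] [Jy' my'] ->]]] := NP (x + y).
    by split=> //; exists x, y.
  by exists x', y'.
Qed.

(** Let [z1] be a small correction for [y] and [z2] one for [ys]. Then [z1 - z2] is small and is a
    sum of an annihilator of [y] and one of [ys]; rewrite it as [a + b] with both terms small. The
    correction [z2 + b = z1 - a] serves [y] and [ys] together. *)
Lemma near_annihilator (ys : seq A) n : exists N, forall x,
  (forall y, y \in ys -> ideal_exp m N (y * x)) ->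
  exists2 z, ideal_exp m n z & forall y, y \in ys -> y * (x - z) = 0.
Proof.
elim: ys n => [|y ys IH] n.
  by exists 0%N => x _; exists 0 => //; exact: ideal_exp0.
pose I := colon [set 0 : A] [set y]; pose J := colon [set 0 : A] [set` ys].
have II : is_ideal I by apply: colon_ideal; exact: set1_0_ideal.
have JI : is_ideal J by apply: colon_ideal; exact: set1_0_ideal.
have [N N_add] := artin_rees_add n II JI.
have [N1 N1P] := artin_rees_mull y (maxn n N).
have [N2 N2P] := IH (maxn n N).
exists (maxn N1 N2) => x mx.
have [|z1 mz1 yz1] := N1P x.
  by apply: (ideal_exp_le (leq_maxl N1 N2)); apply: mx; exact: mem_head.
have [|z2 mz2 ysz2] := N2P x.
  move=> t tys; apply: (ideal_exp_le (leq_maxr N1 N2)).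
  by apply: mx; rewrite in_cons tys orbT.
have [|||a [b [Ia Jb ma mb ab]]] := N_add (z1 - x) (x - z2).
- by move=> _ ->; rewrite /= mulrC mulrBr yz1 subrr.
- by move=> t tys; rewrite /= mulrC; exact: ysz2.
- have -> : z1 - x + (x - z2) = z1 - z2 by ring.
  by apply: ideal_exp_le (leq_maxr n N) _ _; apply: ideal_expD => //; exact: ideal_expN.
exists (z2 + b).
  by apply: ideal_expD => //; exact: ideal_exp_le (leq_maxl n N) _ mz2.
move=> t; rewrite in_cons => /predU1P[->|tys].
  have -> : x - (z2 + b) = x - z1 + a.
    have -> : x - (z2 + b) = z1 - x + (x - z2) - b + x - z1 by ring.
    by rewrite ab; ring.
  by rewrite mulrDr mulrBr yz1 subrr add0r mulrC; exact: Ia.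
by rewrite opprD addrA mulrBr ysz2 // [t * b]mulrC (Jb t tys) subr0.
Qed.

End PowersInIdeal.
End Noetherian.

(** * The completion *)

Section CompletionFacts.
Variables (A : comNzRingType) (m : idealr A).
Hypothesis A_noeth : noetherian_ring A.
Local Notation C := (completion m).
Local Notation expm := (ideal_exp [set` m]).

Definition const_seq_subproof (a : A) : adic_cauchy m (fun=> a).
Proof.
by apply/asboolP => n; exists 0%N => i j _ _; rewrite subrr; exact: ideal_exp0.
Qed.

Definition const_seq (a : A) : cauchy_seq m :=
  exist (adic_cauchy m) (fun=> a) (const_seq_subproof a).

Lemma const_seq_zmod : zmod_morphism const_seq.
Proof. by move=> a b; apply: val_inj. Qed.

Lemma const_seq_monoid : monoid_morphism const_seq.
Proof. by split=> [|a b]; apply: val_inj. Qed.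

HB.instance Definition _ :=
  GRing.isZmodMorphism.Build A (cauchy_seq m) const_seq const_seq_zmod.
HB.instance Definition _ :=
  GRing.isMonoidMorphism.Build A (cauchy_seq m) const_seq const_seq_monoid.

Definition to_completion : {rmorphism A -> C} := \pi_C \o const_seq.

Lemma pi_completionP (x y : cauchy_seq m) :
  \pi_C x = \pi_C y <->
  forall n, exists N, forall i, (N <= i)%N -> expm n (val x i - val y i).
Proof.
split=> [/eqP|H].
  by rewrite -Quotient.idealrBE => /asboolP.
by apply/eqP; rewrite -Quotient.idealrBE; apply/asboolP => n; exact: H.
Qed.

Lemma cauchyP (x : cauchy_seq m) n :
  exists N, forall i j, (N <= i)%N -> (N <= j)%N -> expm n (val x i - val x j).
Proof. by case: x => x /= /asboolP. Qed.

Let m_ideal : is_ideal [set` m] := idealr_is_ideal m.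

Lemma eventually_all (T : eqType) (s : seq T) (P : T -> nat -> Prop) :
  (forall t, exists N, forall i, (N <= i)%N -> t \in s -> P t i) ->
  exists N, forall i, (N <= i)%N -> forall t, t \in s -> P t i.
Proof.
move=> /choice[N NP]; exists (\max_(t <- s) N t)%N => i Ni t ts.
by apply: NP => //; apply: leq_trans Ni; exact: leq_bigmax_seq.
Qed.

(** Late terms of a sequence representing [x] are nearly killed by the generators of [m], hence
    close to socle elements. Since some power of [m] meets the socle in zero, these socle elements
    are eventually constant. *)
Lemma completion_socle (x : C) :
  (forall y, y \in (m : pred A) -> to_completion y * x = 0) ->
  exists2 c, (forall y, y \in (m : pred A) -> y * c = 0) & to_completion c = x.
Proof.
elim/quotW: x => x mx0.
have mx y n : y \in (m : pred A) ->
    exists N, forall i, (N <= i)%N -> expm n (y * val x i).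
  move=> /mx0 yx0; have : \pi_C (const_seq y * x) = \pi_C 0 by rewrite rmorphM rmorph0.
  move=> /pi_completionP/(_ n)[N NP]; exists N => i /NP.
  by rewrite subr0.
have [ys ysE] := A_noeth m_ideal.
have ysm y : y \in ys -> y \in (m : pred A).
  by move=> yys; have : [set` m] y by rewrite ysE; exact: ideal_gen_sub.
have approx n : exists N, forall i, (N <= i)%N ->
    exists2 c, (forall y, y \in (m : pred A) -> y * c = 0) & expm n (val x i - c).
  have [K KP] := near_annihilator A_noeth m_ideal ys n.
  have [|N NP] := @eventually_all A ys (fun y i => expm K (y * val x i)).
    move=> y; have [/ysm/(mx y K)[N NP]|] := boolP (y \in ys).
      by exists N => i /NP.
    by exists 0%N.
  exists N => i /NP/KP[z mz zP]; exists (val x i - z); last first.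
    by have -> : val x i - (val x i - z) = z by ring.
  move=> y ym; have : ideal_gen [set` ys] y by rewrite -ysE.
  move=> /ideal_gen_seqP[c ->]; rewrite big_distrl big1 // => j _ /=.
  by rewrite mulrAC zP ?mul0r // mem_nth.
(* As [m] kills the socle, exponent [1] suffices with [Q = 0]. *)
have [|||N0 N0P] := @artin_rees _ A_noeth _ m_ideal
    (colon [set 0] [set` m]) [set 0] 1.
- by apply: colon_ideal; exact: set1_0_ideal.
- exact: set1_0_ideal.
- by move=> y u ym /(_ y ym); rewrite /= expr1 mulrC.
have [M MP] := approx N0; have [L LP] := cauchyP x N0.
have [|c0 c0m xc0] := MP (maxn M L); first exact: leq_maxl.
exists c0 => //; apply/pi_completionP => n.
have [M' M'P] := approx (maxn n N0); exists (maxn M' L) => i.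
rewrite geq_max => /andP[iM' iL]; have [c cm xc] := M'P i iM'.
suff /eqP : c - c0 = 0.
  rewrite subr_eq0 => /eqP <- /=; rewrite -opprB; apply: ideal_expN.
  exact: ideal_exp_le (leq_maxl n N0) _ xc.
apply: N0P; split; last by move=> y ym; rewrite /= mulrC mulrBr cm // c0m // subr0.
have -> : c - c0 = val x (maxn M L) - c0 + (val x i - val x (maxn M L)) - (val x i - c).
  by ring.
apply: ideal_expD; last by apply: ideal_expN; exact: ideal_exp_le (leq_maxr n N0) _ xc.
by apply: ideal_expD => //; apply: LP => //; exact: leq_maxr.
Qed.

Lemma series_cauchy (t : nat -> A) : (forall l, expm l (t l)) ->
  adic_cauchy m (fun k => \sum_(l < k) t l).
Proof.
move=> tm; apply/asboolP => n; exists n.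
have tail i : (n <= i)%N -> expm n (\sum_(l < i) t l - \sum_(l < n) t l).
  move=> ni; rewrite -!(big_mkord xpredT t) (big_cat_nat (leq0n n) ni) /=.
  rewrite addrAC subrr add0r.
  rewrite big_nat; apply: is_ideal_sum; first exact: ideal_expP.
  by move=> l /andP[nl _]; exact: ideal_exp_le nl _ _.
move=> i j /tail iP /tail jP.
have -> : \sum_(l < i) t l - \sum_(l < j) t l =
    (\sum_(l < i) t l - \sum_(l < n) t l) - (\sum_(l < j) t l - \sum_(l < n) t l).
  by ring.
by apply: ideal_expD => //; exact: ideal_expN.
Qed.

(** Telescope along a fast subsequence: its successive differences lie in [m^(k+1) = m m^k], so they
    are combinations of [ys] with coefficients in [m^k], and the series of coefficients converge to
    the [T j]. *)
Lemma completion_expand (ys : seq A) (x : C) :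
  [set` m] = ideal_gen [set` ys] ->
  exists a (T : 'I_(size ys) -> C),
    x = to_completion a + \sum_(j < size ys) to_completion ys`_j * T j.
Proof.
move=> ysE; elim/quotW: x => x.
have /choice[N NP] := fun k => cauchyP x k.+1.
(* The sum serves as a common upper bound of [N 0], ..., [N k]. *)
pose M k := (\sum_(l < k.+1) N l)%N.
have NM k l : (k <= l)%N -> (N k <= M l)%N.
  by move=> kl; rewrite /M (bigD1 (inord k)) //= inordK // leq_addr.
have step k : exists t : 'I_(size ys) -> A, (forall j, expm k (t j)) /\
    val x (M k.+1) - val x (M k) = \sum_(j < size ys) ys`_j * t j.
  have : expm k.+1 (val x (M k.+1) - val x (M k)) by apply: NP; exact: NM.
  by rewrite /ideal_exp /= -/(expm k) ysE; apply: ideal_mul_genP; exact: ideal_expP.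
have [t tP] := choice step.
pose T j : cauchy_seq m :=
  exist (adic_cauchy m) _ (series_cauchy (fun l => (tP l).1 j)).
exists (val x (M 0%N)), (fun j => \pi_C (T j)).
have -> : to_completion (val x (M 0%N)) +
    \sum_(j < size ys) to_completion ys`_j * \pi_C (T j) =
    \pi_C (const_seq (val x (M 0%N)) + \sum_(j < size ys) const_seq ys`_j * T j).
  rewrite rmorphD rmorph_sum; congr (_ + _).
  by apply: eq_bigr => j _; rewrite rmorphM.
apply/pi_completionP => n.
(* The representative of the right-hand side telescopes exactly to the subsequence [x (M k)], which
   has the same limit as [x]. *)
have partial k : val (const_seq (val x (M 0%N)) + \sum_(j < size ys) const_seq ys`_j * T j) k
    = val x (M k).
  rewrite rmorphD rmorph_sum /= fctE fct_sumE.
  under eq_bigr do rewrite fctE /=.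
  elim: k => [|k IH]; first by rewrite big1 ?addr0 // => j _; rewrite big_ord0 mulr0.
  under eq_bigr do rewrite big_ord_recr /= mulrDr.
  by rewrite big_split /= addrA IH -(tP k).2 addrC subrK.
exists (maxn n (N n)) => i; rewrite geq_max => /andP[ni Ni].
rewrite partial; apply: ideal_exp_le (leqnSn n) _ _; apply: NP => //.
exact: NM.
Qed.

End CompletionFacts.

(** * Direct summands *)

Section Splitting.
Variables (A : comNzRingType) (K N : lmodType A).
Variables (p : {linear N -> K}) (s : {linear K -> N}).

Definition in_kernel : pred N := fun x => p x == 0.

Lemma in_kernel_submod : submod_closed in_kernel.
Proof.
split=> [|a x y /eqP px /eqP py]; apply/eqP; first exact: linear0.
by rewrite linearP px py scaler0 addr0.
Qed.

HB.instance Definition _ :=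
  GRing.isSubmodClosed.Build A N in_kernel in_kernel_submod.

Definition kernel_module : Type := {x : N | in_kernel x}.

HB.instance Definition _ := SubChoice.on kernel_module.
HB.instance Definition _ := [SubChoice_isSubLmodule of kernel_module by <:].

Hypothesis sK : cancel s p.

Lemma retract_in_kernel x : in_kernel (x - s (p x)).
Proof. by rewrite /in_kernel linearB /= sK subrr. Qed.

Definition splitting (x : N) : (K * kernel_module)%type :=
  (p x, exist in_kernel _ (retract_in_kernel x)).

Lemma splitting_linear : linear splitting.
Proof.
move=> a x y; congr (_, _); first exact: linearP.
apply: val_inj; rewrite /= !linearP /= scalerBr.
by rewrite scalerN addrACA.
Qed.

HB.instance Definition _ :=
  GRing.isLinear.Build A N (K * kernel_module)%type *:%R splitting splitting_linear.

Lemma direct_summand_retract : direct_summand K N.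
Proof.
exists kernel_module, splitting.
exists (fun z => s z.1 + val z.2) => [x|[q [x xker]]] /=.
  by rewrite addrC subrK.
have pE : p (s q + x) = q by rewrite linearD /= sK (eqP xker) addr0.
by congr (_, _) => //; apply: val_inj; rewrite /= pE addrC addKr.
Qed.

End Splitting.

Lemma pi_ideal_eq0 (A : comNzRingType) (I : idealr A) x :
  (\pi_{ideal_quot I} x == 0) = (x \in (I : pred A)).
Proof. by rewrite -(rmorph0 \pi_{ideal_quot I}) -Quotient.idealrBE subr0. Qed.

(** * The residue field as a summand of the image of a matrix *)

Section ImageSummand.
Variables (A : comNzRingType) (m : idealr A) (k n : nat) (D : 'M[A]_(k, n)).
Local Notation N := (image_module D).

Lemma image_of_subproof v : in_image D (v *m D).
Proof. by apply/asboolP; exists v. Qed.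

Definition image_of v : N := exist (in_image D) _ (image_of_subproof v).

Lemma image_of_linear : linear image_of.
Proof. by move=> a v w; apply: val_inj; rewrite /= mulmxDl scalemxAl. Qed.

HB.instance Definition _ :=
  GRing.isLinear.Build A 'rV[A]_k N *:%R image_of image_of_linear.

Lemma image_of_surj (x : N) : exists v, image_of v = x.
Proof. by case: x => x xD; have /asboolP[v xE] := xD; exists v; apply: val_inj. Qed.

Variable l : 'I_k.
Hypothesis ker_l : forall v : 'rV_k, v *m D = 0 -> v 0 l \in (m : pred A).

(** The preimage is an arbitrary choice; under [ker_l] two preimages have the same coordinate [l]
    modulo [m]. *)
Definition image_coord (x : N) : quot_module m :=
  \pi_{ideal_quot m} (sval (cid (image_of_surj x)) 0 l).

Lemma image_coordE v : image_coord (image_of v) = \pi_{ideal_quot m} (v 0 l).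
Proof.
rewrite /image_coord; case: cid => w /= /(congr1 val) /= wv.
apply/eqP; rewrite -Quotient.idealrBE.
suff : (w - v) 0 l \in (m : pred A) by rewrite !mxE.
by apply: ker_l; rewrite mulmxBl wv subrr.
Qed.

Lemma image_coord_linear : linear image_coord.
Proof.
move=> a x y; have [v <-] := image_of_surj x; have [w <-] := image_of_surj y.
rewrite -linearP !image_coordE !mxE rmorphD rmorphM.
by [].
Qed.

End ImageSummand.

Section SocleMap.
Variables (A : comNzRingType) (m : idealr A) (N : lmodType A) (w : N).
Hypothesis mw0 : forall y, y \in (m : pred A) -> y *: w = 0.

(** The representative does not matter, because [m] kills [w]. *)
Definition socle_map (q : quot_module m) : N := repr (q : {ideal_quot m}) *: w.

Lemma socle_map_pi a : socle_map (\pi_{ideal_quot m} a) = a *: w.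
Proof.
apply/eqP; rewrite -subr_eq0 -scalerBl; apply/eqP/mw0.
by rewrite Quotient.idealrBE reprK.
Qed.

Lemma socle_map_linear : linear socle_map.
Proof.
move=> a; elim/quotW=> x; elim/quotW=> y.
transitivity (socle_map (\pi_{ideal_quot m} (a * x + y))).
  by rewrite rmorphD rmorphM.
by rewrite !socle_map_pi scalerDl scalerA.
Qed.

End SocleMap.

(** Sending [1] to the socle element [a u D] embeds the residue field, and coordinate [l] modulo [m]
    is a retraction since [a u] has coordinate [1] there. *)
Lemma image_summand (A : comNzRingType) (m : idealr A) (k n : nat)
    (D : 'M[A]_(k, n)) (l : 'I_k) (u : 'rV[A]_k) a :
  (forall v : 'rV_k, v *m D = 0 -> v 0 l \in (m : pred A)) ->
  (forall y, y \in (m : pred A) -> y *: (u *m D) = 0) -> u 0 l * a = 1 ->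
  direct_summand (quot_module m) (image_module D).
Proof.
move=> ker_l mu ua.
have mw y : y \in (m : pred A) -> y *: image_of D (a *: u) = 0.
  move=> ym; rewrite -linearZ; apply: val_inj => /=.
  by rewrite scalerA mulrC -scalerA -scalemxAl -scalemxAl mu ?scaler0.
pose p : {linear image_module D -> quot_module m} := HB.pack (image_coord m l)
  (GRing.isLinear.Build A _ _ *:%R _ (image_coord_linear ker_l)).
pose s : {linear quot_module m -> image_module D} := HB.pack
  (socle_map (image_of D (a *: u)))
  (GRing.isLinear.Build A _ _ *:%R _ (socle_map_linear mw)).
apply: (@direct_summand_retract _ _ _ p s).
elim/quotW => x; rewrite /= socle_map_pi // -linearZ /= image_coordE // !mxE.
by rewrite [a * _]mulrC ua mulr1.
Qed.

(** * Syzygies over a Burch ring *)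

Section Resolution.
Variables (R : comNzRingType) (m : idealr R).
Hypothesis R_local : noetherian_local_ring m.
Variables (M : lmodType R) (F : minimal_free_resolution m M).

Let R_unit x : x \notin (m : pred R) -> exists y, x * y = 1.
Proof. by case: (R_local) => R_noeth _ _; exact: local_unit. Qed.

Lemma entries_ideal_sub : entries_ideal F `<=` [set` m].
Proof.
apply: ideal_gen_min; first exact: idealr_is_ideal.
by move=> _ [i [a [b ->]]]; exact: minimal_diff.
Qed.

Lemma mem_entries i a b : entries_ideal F (diff F i a b).
Proof. by apply: ideal_gen_sub; exists i, a, b. Qed.

(* A generator of the summand [k] lifts to a row vector [v] with a unit
   coordinate, and [m v] lies in the image of the next differential. *)
Lemma summand_entries i :
  direct_summand (quot_module m) (image_module (diff F i)) ->
  [set` m] `<=` entries_ideal F.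
Proof.
move=> [L [f [g fK gK]]].
have [v vE] := image_of_surj (g (1, 0)).
have fv : (f (image_of (diff F i) v)).1 = 1 :> {ideal_quot m} by rewrite vE gK.
have [l vl] : exists l, v 0 l \notin (m : pred R).
  apply: contrapT => /forallNP vm.
  suff : (f (image_of (diff F i) v)).1 = 0 :> {ideal_quot m}.
    by rewrite fv => /eqP; rewrite oner_eq0.
  rewrite [v]row_sum_delta !linear_sum /=.
  rewrite big1 // => j _; rewrite !linearZ /=.
  set q := (f _).1.
  transitivity (\pi_{ideal_quot m} (v 0 j) * (q : {ideal_quot m})) => //.
  suff /eqP -> : \pi_{ideal_quot m} (v 0 j) == 0 by rewrite mul0r.
  by rewrite pi_ideal_eq0; apply: contrapT => /negP; exact: vm.
have [a va] := R_unit vl.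
move=> x /= xm.
have : x *: v *m diff F i = 0.
  suff : image_of (diff F i) (x *: v) = 0 by move/(congr1 val).
  apply: (can_inj fK); rewrite linear0 !linearZ /= vE gK.
  congr (_, _); last exact: scaler0.
  transitivity (\pi_{ideal_quot m} x * 1) => //.
  by apply/eqP; rewrite mulr1 pi_ideal_eq0.
move=> /exact_diff[u xv].
have <- : a * (x *: v) 0 l = x by rewrite mxE mulrCA [a * _]mulrC va mulr1.
have EI : is_ideal (entries_ideal F) by exact: ideal_gen_ideal.
apply: (is_idealMl _ EI); rewrite xv mxE; apply: is_ideal_sum => // j _.
by apply: (is_idealMl _ EI); exact: mem_entries.
Qed.

(* If [k] is not a summand of the syzygy [Z = ker (diff F i)], the socle of
   [F_(i+1)] lies in [m Z]. *)
Lemma socle_no_summand i (c : R) (a : 'I_(rk F i.+1)) :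
  (forall y, y \in (m : pred R) -> y * c = 0) ->
  ~ direct_summand (quot_module m) (image_module (diff F i.+1)) ->
  exists2 u : 'rV_(rk F i.+2), (forall j, u 0 j \in (m : pred R)) &
    c *: delta_mx 0 a = u *m diff F i.+1.
Proof.
move=> mc nosum.
have [u uE] : exists u : 'rV_(rk F i.+2), c *: delta_mx 0 a = u *m diff F i.+1.
  apply/exact_diff; rewrite -scalemxAl -rowE; apply/rowP => j.
  by rewrite !mxE mulrC mc // minimal_diff.
(* A unit coordinate of [u] would split off the residue field by [image_summand]: the kernel of
   [diff F i.+1] has coordinates in [m] by exactness and minimality. *)
exists u => // l; apply: contrapT => /negP ul; apply: nosum.
have [b ub] := R_unit ul.
apply: (image_summand (l := l) (u := u) _ _ ub).
  move=> v /exact_diff[w ->]; rewrite mxE; apply: rpred_sum => j _.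
  by apply: idealMr; exact: minimal_diff.
by move=> y ym; rewrite -uE scalerA mc // scale0r.
Qed.

Lemma diff_diff i : diff F i.+1 *m diff F i = 0.
Proof.
apply/row_matrixP => j; rewrite row_mul row0; apply/exact_diff.
by exists (delta_mx 0 j); rewrite -rowE.
Qed.

End Resolution.

(** * The completion as a quotient by a Burch ideal *)

Section BurchPresentation.
Variables (R : comNzRingType) (m : idealr R).
Hypotheses (R_local : noetherian_local_ring m) (R_depth0 : has_depth R 0).
Let R_noeth : noetherian_ring R. Proof. by case: R_local. Qed.

(* Depth zero forces the regular sequence of [burch_ring] to be empty, so [g] is
   the map from [R] to its completion [S/I]. *)
Lemma burch_presentation : burch_ring m ->
  exists (S : comNzRingType) (n I : idealr S) (g : {rmorphism R -> {ideal_quot I}}),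
    [/\ noetherian_local_ring n, burch_ideal n I,
        (forall x s, x \in (m : pred R) -> \pi_{ideal_quot I} s = g x ->
           s \in (n : pred S)),
        (forall Q, is_ideal Q -> [set` I] `<=` Q ->
           (forall x s, x \in (m : pred R) -> \pi_{ideal_quot I} s = g x -> Q s) ->
           [set` n] `<=` Q) &
        (forall b, colon [set` I] [set` n] b ->
           exists2 c, (forall y, y \in (m : pred R) -> y * c = 0) &
             g c = \pi_{ideal_quot I} b)].
Proof.
move=> [t [xs [X [tdepth [_ xst] XE [S [n [I [Slocal nI [f fbij]]]]]]]]].
have xs0 : xs = [::].
  case: tdepth => -[zs [/(R_depth0.2 zs)+ zst]] _.
  by rewrite zst -xst leqn0 => /nilP.
have X0 x : x \in (X : pred (completion m)) -> x = 0.
  move=> xX; have : [set` X] x by [].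
  rewrite XE xs0; apply: (@ideal_gen_min _ _ [set 0]); first exact: set1_0_ideal.
  by [].
pose h : {rmorphism completion m -> {ideal_quot I}} := f \o \pi_{ideal_quot X}.
have h_inj x : h x = 0 -> x = 0.
  move=> /eqP; rewrite -(rmorph0 f) /= (inj_eq (bij_inj fbij)) => /eqP/eqP.
  by rewrite pi_ideal_eq0 => /X0.
have h_surj q : exists x, h x = q.
  have [f' _ f'K] := fbij; exists (repr (f' q)).
  by rewrite /= reprK f'K.
have [Sloc _] := Slocal.
have [S_noeth _ _] := Sloc.
pose g : {rmorphism R -> {ideal_quot I}} := h \o to_completion m.
(* If [s] were a unit, [x] would be invertible in the completion; reading the inverse relation
   modulo [m] would put [1] in [m]. *)
have gm x s : x \in (m : pred R) -> \pi_{ideal_quot I} s = g x -> s \in (n : pred S).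
  move=> xm sx; apply: contrapT => /negP /(local_unit S_noeth Sloc)[r sr].
  have [t' t'E] := h_surj (\pi_{ideal_quot I} r).
  have : to_completion m x * t' = 1.
    apply/eqP; rewrite -subr_eq0; apply/eqP/h_inj.
    by rewrite rmorphB rmorphM rmorph1 t'E -[h _]/(g x) -sx -rmorphM sr rmorph1 subrr.
  elim/quotW: t' {t'E} => T xT.
  have : \pi_(completion m) (const_seq m x * T) = \pi_(completion m) 1.
    by rewrite rmorphM xT rmorph1.
  move=> /pi_completionP/(_ 1%N)[N /(_ N (leqnn N))].
  rewrite ideal_exp1; last exact: idealr_is_ideal.
  move=> xT1; have xTm : x * val T N - 1 \in (m : pred R) by exact: xT1.
  have : 1 \in (m : pred R).
    have -> : 1 = x * val T N - (x * val T N - 1) :> R by ring.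
    by rewrite rpredB // mulrC idealMr.
  by rewrite idealr1.
exists S, n, I, g; split=> //.
- move=> Q QI IQ mQ s sn.
  have [ys ysE] := R_noeth (idealr_is_ideal m).
  have ysm j : (j < size ys)%N -> ys`_j \in (m : pred R).
    move=> jys; have : [set` m] ys`_j.
      by rewrite ysE; apply: ideal_gen_sub; exact: mem_nth.
    by [].
  have [x xs'] := h_surj (\pi_{ideal_quot I} s).
  have [a [T xE]] := completion_expand x ysE.
  (* [w] lifts the part of the expansion of [s] that lies in the extension of [m], so [s - w] lifts
     [g a]. *)
  pose w := \sum_(j < size ys) repr (g ys`_j) * repr (h (T j)).
  have sw : \pi_{ideal_quot I} (s - w) = g a.
    have wh : \pi_{ideal_quot I} w = h (\sum_(j < size ys) to_completion m ys`_j * T j).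
      rewrite !rmorph_sum; apply: eq_bigr => j _; rewrite !rmorphM.
      by congr (_ * _); exact: reprK.
    by rewrite rmorphB /= wh -xs' xE rmorphD addrK.
  have wP (P : set S) : is_ideal P -> (forall j : 'I_(size ys), P (repr (g ys`_j))) -> P w.
    move=> PI H; apply: is_ideal_sum => // j _; exact: is_idealMr.
  have wQ : Q w by apply: wP => // j; apply: (mQ ys`_j); [exact: ysm|exact: reprK].
  have [am|am] := boolP (a \in (m : pred R)).
    have -> : s = s - w + w by rewrite subrK.
    by apply: is_idealD => //; exact: (mQ a).
  have wn : [set` n] w.
    apply: wP; first exact: idealr_is_ideal.
    by move=> j; apply: (gm ys`_j); [exact: ysm|exact: reprK].
  have [b ab] := local_unit R_noeth R_local am.
  have : (s - w) * repr (g b) - 1 \in (I : pred S).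
    by rewrite Quotient.idealrBE rmorphM /= sw reprK -rmorphM ab !rmorph1.
  (* If [a] is a unit, [s - w] is invertible modulo [I], although [s] and [w] lie in [n]. Taking
     [x = 0] in [gm] shows that [I] lies in [n], which makes this absurd. *)
  move=> I1; have In : (s - w) * repr (g b) - 1 \in (n : pred S).
    apply: (gm 0); first exact: rpred0.
    by rewrite rmorph0; apply/eqP; rewrite pi_ideal_eq0.
  have : 1 \in (n : pred S).
    have -> : 1 = (s - w) * repr (g b) - ((s - w) * repr (g b) - 1) :> S by ring.
    by rewrite rpredB // mulrC idealMr // rpredB.
  by rewrite idealr1.
- move=> b bn; have [x xb] := h_surj (\pi_{ideal_quot I} b).
  have [|c mc cx] := @completion_socle _ _ R_noeth x; last first.
    by exists c => //; rewrite -[g c]/(h (to_completion m c)) cx.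
  move=> y ym; apply: h_inj; rewrite rmorphM xb -[h _]/(g y) -[g y]reprK -rmorphM.
  apply/eqP; rewrite pi_ideal_eq0 mulrC; apply: bn => /=.
  by apply: (gm y) => //; rewrite reprK.
Qed.

End BurchPresentation.

Theorem theorem1p3 (R : comNzRingType) (m : idealr R)
    (R_local : noetherian_local_ring m) (R_burch : burch_ring m)
    (R_depth0 : has_depth R 0) (R_not_field : ~ is_field R)
    (M : lmodType R) (M_fg : finitely_generated M)
    (F : minimal_free_resolution m M) :
  entries_ideal F = [set` m] <->
  exists r, (2 <= r)%N /\ direct_summand (quot_module m) (syzygy F r).
Proof.
split; last first.
  move=> [[|r] [// r2 sum]]; apply/seteqP; split; first exact: entries_ideal_sub.
  exact: summand_entries sum.
move=> Fm; apply: contrapT => nosum.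
have [S [n [I [g [S_local nI gm nQ socle]]]]] :=
  burch_presentation R_local R_depth0 R_burch.
have [R_noeth _ _] := R_local.
have nII : is_ideal (ideal_mul [set` n] [set` I]) by exact: ideal_gen_ideal.
apply: nI; apply/seteqP; split; apply: ideal_mul_min.
- exact: ideal_gen_ideal.
- move=> s b sn bI; apply: ideal_mul_prod => // t _.
  by rewrite mulrC; exact: idealMr.
- exact: ideal_gen_ideal.
move=> s b sn bI; have [c mc gc] := socle b bI.
have liftI s' t' : \pi_{ideal_quot I} s' = \pi_{ideal_quot I} t' -> [set` I] (s' - t').
  by move=> /eqP; rewrite -Quotient.idealrBE.
(* This gives [b I] inside [n I]. If [c] were a unit, [m c = 0] would force [m = 0], making [R] a
   field. *)
have bn : b \in (n : pred S).
  have [cm|/(local_unit R_noeth R_local)[d cd]] := boolP (c \in (m : pred R)).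
    by apply: (gm c) => //; rewrite gc.
  exfalso; apply: R_not_field => x x0; apply: (local_unit R_noeth R_local).
  apply/negP => /mc xc; move/eqP: x0; apply.
  by rewrite -[x]mulr1 -cd mulrA xc mul0r.
rewrite mulrC; pose Q := colon (ideal_mul [set` n] [set` I]) [set b].
suff : [set` n] `<=` Q by move=> /(_ s sn b erefl); rewrite mulrC.
have QI : is_ideal Q by exact: colon_ideal.
have IQ : [set` I] `<=` Q by move=> t It _ ->; rewrite mulrC; exact: ideal_mul_prod.
apply: nQ => // x t xm; have : entries_ideal F x by rewrite Fm.
(* Since [Q] contains [I], the choice of lift is immaterial and the elements of [R] whose lifts lie
   in [Q] form an ideal. It is then enough to treat the entries, which generate [m]. *)
have QgI : is_ideal [set x | forall t, \pi_{ideal_quot I} t = g x -> Q t].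
  split=> /=.
  - move=> t0 /eqP; rewrite rmorph0 pi_ideal_eq0; exact: IQ.
  - move=> y z Qy Qz t0; rewrite rmorphD => t0E.
    rewrite -[t0](subrK (repr (g y))); apply: (is_idealD QI).
      by apply: Qz; rewrite rmorphB /= reprK t0E addrAC subrr add0r.
    by apply: Qy; rewrite reprK.
  - move=> y z Qz t0; rewrite rmorphM => t0E.
    rewrite -[t0](subrK (repr (g y) * repr (g z))); apply: (is_idealD QI).
      by apply: IQ; apply: liftI; rewrite rmorphM /= !reprK.
    by apply: (is_idealMl _ QI); apply: Qz; rewrite reprK.
have entriesQ i p q : forall t, \pi_{ideal_quot I} t = g (diff F i p q) -> Q t.
  move=> t0 t0E.
  (* The image of [diff F i.+1] is the syzygy of index [i + 2], so the bound [2 <= r] covers all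
     entries from [diff F 0] on. *)
  have [|u um cu] := socle_no_summand R_local p mc (i := i) (F := F).
    by move=> sum; apply: nosum; exists i.+2.
  pose D := \matrix_(l, j) repr (g (diff F i l j)).
  pose D' := \matrix_(l, j) repr (g (diff F i.+1 l j)).
  have Dn l j : [set` n] (D l j).
    by rewrite mxE; apply: (gm (diff F i l j)); [exact: minimal_diff|exact: reprK].
  (* [e] is the error, with coordinates in [I], in lifting the relation
     [c *: delta_mx 0 p = u *m diff F i.+1] to [S]. *)
  pose e (l : 'I_(rk F i.+1)) := b * (l == p)%:R - \sum_j repr (g (u 0 j)) * D' j l.
  have eI l : [set` I] (e l).
    apply: liftI; rewrite rmorphM rmorph_nat /= -gc rmorph_sum /=.
    transitivity (g ((c *: delta_mx 0 p : 'rV_(rk F i.+1)) 0 l)).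
      by rewrite !mxE eqxx /= rmorphM rmorph_nat.
    rewrite cu mxE rmorph_sum; apply: eq_bigr => j _.
    by rewrite !mxE !rmorphM /= !reprK.
  have DDI j : [set` I] (\sum_l D' j l * D l q).
    rewrite -[X in [set` I] X]subr0; apply: liftI; rewrite rmorph0 rmorph_sum.
    transitivity (g ((diff F i.+1 *m diff F i) j q)); last first.
      by rewrite diff_diff mxE rmorph0.
    rewrite mxE rmorph_sum; apply: eq_bigr => l _.
    by rewrite !mxE !rmorphM; congr (_ * _); exact: reprK.
  have sum_be : \sum_l D l q * (b * (l == p)%:R) = b * D p q.
    rewrite (bigD1 p) //= eqxx mulr1 mulrC big1 ?addr0 // => l /negPf ->.
    by rewrite mulr0 mulr0.
  have sum_uD : \sum_l D l q * (\sum_j repr (g (u 0 j)) * D' j l) =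
      \sum_j repr (g (u 0 j)) * \sum_l D' j l * D l q.
    under eq_bigr do rewrite big_distrr.
    rewrite exchange_big; apply: eq_bigr => j _; rewrite big_distrr.
    by apply: eq_bigr => l _; rewrite /= mulrC mulrA.
  (* Column [q] of [D] is applied to the lifted relation. The first sum is in [n I] because [D] has
     entries in [n] and [e] in [I]; the second because the lifts of [u] are in [n] and [D' D] has
     entries in [I]. *)
  have DpqE : b * D p q = \sum_l D l q * e l +
      \sum_j repr (g (u 0 j)) * \sum_l D' j l * D l q.
    under [X in _ = X + _]eq_bigr do rewrite /e mulrBr.
    by rewrite sumrB sum_be sum_uD subrK.
  rewrite -[t0](subrK (D p q)); apply: (is_idealD QI).
    by apply: IQ; apply: liftI; rewrite t0E mxE reprK.
  move=> _ ->; rewrite mulrC DpqE; apply: (is_idealD nII).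
    apply: (is_ideal_sum _ nII) => l _; exact: ideal_mul_prod.
  apply: (is_ideal_sum _ nII) => l _.
  by apply: ideal_mul_prod => //; apply: (gm (u 0 l)) => //; exact: reprK.
move=> Ex xt; move: x Ex t xt {xm}.
by apply: ideal_gen_min => // _ [i [p [q ->]]]; exact: entriesQ.
Qed.
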